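(* Let $\mathcal{C}_W$ be the category described in the context, let $p:\widehat{\mathcal{C}_W}\to\mathbf{Set}$ be the canonical geometric morphism from the topos of presheaves on $\mathcal{C}_W$, and let $\pi_0=p^*p_!:\widehat{\mathcal{C}_W}\to\widehat{\mathcal{C}_W}$, where $p_!$ is the left adjoint of $p^*$ (the colimit functor). Let $R$ be the presheaf represented by $\mathrm{Spec}(C^\infty(\mathbb{R}))$, a ring object. Let $U\rightarrowtail R$ be the subobject of invertible elements, let $U_+\rightarrowtail U$ be the kernel of the group morphism $U\to\pi_0 U$ (i.e. the pullback of $\pi_0(1):\pi_0\mathbf{1}\to\pi_0 U$ along the unit $U\to\pi_0U$, where $1:\mathbf{1}\to U$ is the unit of $R$). Define, in the internal language, $A=\{a\in R\mid a+U_+\subseteq U_+\}$ and $M=\{\lambda\in R\mid \lambda A\subseteq A\}$. Let $H\rightarrowtail R$ be the monomorphism (between representables) induced by the quotient $C^\infty(\mathbb{R})\to C^\infty[0,\infty)$. Then, in $\widehat{\mathcal{C}_W}$, the subobjects $M\rightarrowtail R$ and $H\rightarrowtail R$ coincide.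
   Context: A $C^\infty$-ring is a model of the algebraic theory whose $n$-ary operations (for each finite $n$) are the smooth functions $\mathbb{R}^n\to\mathbb{R}$; $C^\infty$-rings and their homomorphisms form the category $C^\infty\text{-}\mathbf{Ring}$. For a manifold $N$, $C^\infty(N)$ denotes the $C^\infty$-ring of smooth real functions on $N$. $\mathrm{Aff}_{C^\infty}$ is the opposite of the category of finitely generated $C^\infty$-rings; a finitely generated $C^\infty$-ring $A$ viewed as an object of it is written $\mathrm{Spec}\,A$. This category is extensive; an object is connected if it has exactly two complemented subobjects (equivalently the $C^\infty$-ring has exactly two idempotents), and a point of $\mathrm{Spec}\,A$ is a map from the terminal object $\mathrm{Spec}\,\mathbb{R}$, i.e. a $C^\infty$-ring homomorphism $A\to\mathbb{R}$. $\mathcal{C}$ is the (essentially small) full subcategory of $\mathrm{Aff}_{C^\infty}$ of connected objects that have a point. A Weil algebra is a finite-dimensional commutative $\mathbb{R}$-algebra of the form $\mathbb{R}\oplus N$ with $N$ a nilpotent ideal; it carries a canonical $C^\infty$-ring structure. A $C^\infty$-ring $A$ is W-determined if the family of all $C^\infty$-ring homomorphisms $A\to W$ with $W$ a Weil algebra is jointly monic. $\mathcal{C}_W$ is the full subcategory of $\mathcal{C}$ on the objects $\mathrm{Spec}\,A$ with $A$ W-determined. $C^\infty[0,\infty)=C^\infty(\mathbb{R})/I$, where $I$ is the ideal of smooth functions $\mathbb{R}\to\mathbb{R}$ vanishing on $[0,\infty)$; it is W-determined and $H=\mathrm{Spec}(C^\infty[0,\infty))$ is an object of $\mathcal{C}_W$.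 *)

(* Defs.v *)
From HB Require Import structures.
From Stdlib Require Import ClassicalEpsilon.
From mathcomp Require Import all_boot all_order all_algebra.
From mathcomp Require Import falgebra.
From mathcomp Require Import all_classical all_reals all_analysis.

Set Implicit Arguments.
Unset Strict Implicit.
Unset Printing Implicit Defensive.

Import Order.TTheory GRing.Theory Num.Theory.
Import numFieldNormedType.Exports.
Local Open Scope ring_scope.

Section Defs.
Variable RR : realType.

Definition ebase (n : nat) (i : 'I_n) : 'rV[RR]_n := delta_mx 0 i.

Fixpoint iterD (n : nat) (s : seq 'I_n) (f : 'rV[RR]_n -> RR) : 'rV[RR]_n -> RR :=
  match s with
  | [::] => f
  | i :: s' => fun x => 'D_(ebase i) (iterD s' f) x
  end.

Definition smooth (n : nat) (f : 'rV[RR]_n -> RR) : Prop :=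
  forall s : seq 'I_n,
    continuous (iterD s f) /\ forall (i : 'I_n) (x : 'rV[RR]_n), derivable (iterD s f) x (ebase i).

Definition smooth1 (g : RR -> RR) : Prop := smooth (fun v : 'rV[RR]_1 => g (v 0 0)).

(* a set with an interpretation of every n-ary smooth function (values on
   non-smooth functions are irrelevant junk) *)
Record preC := PreC {
  car :> Type;
  op : forall n : nat, ('rV[RR]_n -> RR) -> ('I_n -> car) -> car }.
Arguments op p {n}.

Definition is_hom (A B : preC) (h : A -> B) : Prop :=
  forall (n : nat) (f : 'rV[RR]_n -> RR) (xs : 'I_n -> A),
    smooth f -> h (op A f xs) = op B f (fun i => h (xs i)).

(* models of the Lawvere theory of smooth functions: projections and substitution *)
Record CRing := CRingMk {
  crpre :> preC;
  cr_proj : forall (n : nat) (i : 'I_n) (xs : 'I_n -> crpre),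
      op crpre (fun v : 'rV[RR]_n => v 0 i) xs = xs i;
  cr_comp : forall (n m : nat) (f : 'rV[RR]_n -> RR) (g : 'I_n -> 'rV[RR]_m -> RR)
      (xs : 'I_m -> crpre),
      smooth f -> (forall i, smooth (g i)) ->
      op crpre (fun x => f (\row_i g i x)) xs = op crpre f (fun i => op crpre (g i) xs) }.

Lemma I0_false (i : 'I_0) : False. Proof. by case: i. Qed.
Definition noargs (T : Type) (i : 'I_0) : T := False_rect T (I0_false i).
Definition args2 (T : Type) (x y : T) (i : 'I_2) : T := if val i == 0%N then x else y.

Definition czero (A : preC) : A := op A (fun _ : 'rV[RR]_0 => 0) (@noargs A).
Definition cone (A : preC) : A := op A (fun _ : 'rV[RR]_0 => 1) (@noargs A).
Definition cadd (A : preC) (x y : A) : A := op A (fun v : 'rV[RR]_2 => v 0 0 + v 0 1) (args2 x y).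
Definition cmul (A : preC) (x y : A) : A := op A (fun v : 'rV[RR]_2 => v 0 0 * v 0 1) (args2 x y).

Definition realC : preC := @PreC RR (fun n f xs => f (\row_i xs i)).

Definition nilp (W : falgType RR) (w : W) : Prop := exists m : nat, w ^+ m = 0.

(* finite dimensional commutative R-algebra W = R.1 (+) N with N nilpotent
   (N is then the ideal of nilpotent elements) *)
Definition Weil (W : falgType RR) : Prop :=
  (forall x y : W, x * y = y * x) /\ (forall w : W, exists a : RR, nilp (w - a%:A)).

Definition wpart (W : falgType RR) (w : W) : RR :=
  epsilon (inhabits 0) (fun a : RR => nilp (w - a%:A)).

(* Taylor formula  f(a + n) = sum_k 1/k! sum_{i_1..i_k} d_{i_1..i_k} f(a) n_{i_1}...n_{i_k}
   (finite since N^(dim W) = 0) *)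
Definition weilOp (W : falgType RR) (n : nat) (f : 'rV[RR]_n -> RR) (ws : 'I_n -> W) : W :=
  \sum_(k < (\dim {:W}).+1)
     (k`!%:R)^-1 *:
       \sum_(s : k.-tuple 'I_n)
          (iterD s f (\row_i wpart (ws i))) *:
            \prod_(j < k) (ws (tnth s j) - (wpart (ws (tnth s j)))%:A).

Definition weilC (W : falgType RR) : preC := @PreC W (@weilOp W).

Definition fin_gen (A : CRing) : Prop :=
  exists (n : nat) (xs : 'I_n -> A), forall a : A, exists f, smooth f /\ a = op A f xs.

Definition W_determined (A : CRing) : Prop :=
  forall a b : A,
    (forall (W : falgType RR), Weil W -> forall h : A -> weilC W, is_hom h -> h a = h b) ->
    a = b.

Definition connectedC (A : CRing) : Prop :=
  cone A <> czero A /\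
  forall e : A, cmul e e = e -> e = czero A \/ e = cone A.

Definition has_point (A : CRing) : Prop := exists h : A -> realC, is_hom h.

Record CWobj := CWObj {
  cwring :> CRing;
  cw_fg : fin_gen cwring;
  cw_Wdet : W_determined cwring;
  cw_conn : connectedC cwring;
  cw_pt : has_point cwring }.

(* A morphism Spec A -> Spec B in C_W is a C^infinity-homomorphism h : B -> A.
   Presheaves are thus covariant in the rings.  The generic ring object R
   (represented by Spec C^oo(R), the free C^oo-ring on one generator) is
   R(Spec A) = A, with R(h) = h. *)

Definition isunit (X : CWobj) (u : X) : Prop := exists v : X, cmul u v = cone X.

Definition elU := {X : CWobj & car X}.

(* the equivalence relation whose classes form  p_! U = colim U
   (connected components of the category of elements of U) *)
Inductive zz : elU -> elU -> Prop :=
  | zz_step (X Y : CWobj) (h : X -> Y) (u : X) :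
      is_hom h -> isunit u -> zz (existT _ X u) (existT _ Y (h u))
  | zz_refl p : zz p p
  | zz_sym p q : zz p q -> zz q p
  | zz_trans p q r : zz p q -> zz q r -> zz p r.

Definition Uplus (X : CWobj) (u : X) : Prop :=
  isunit u /\ exists Y : CWobj, zz (existT _ X u) (existT _ Y (cone Y)).

(* Kripke-Joyal interpretation of A = {a in R | a + U_+ subset U_+} *)
Definition Aset (X : CWobj) (a : X) : Prop :=
  forall (Y : CWobj) (h : X -> Y), is_hom h ->
    forall u : Y, Uplus u -> Uplus (cadd (h a) u).

Definition Mset (X : CWobj) (l : X) : Prop :=
  forall (Y : CWobj) (h : X -> Y), is_hom h ->
    forall a : Y, Aset a -> Aset (cmul (h l) a).

(* H(Spec A) = Hom(C^oo[0,oo), A) as a subset of R(Spec A) = Hom(C^oo(R), A) = A: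
   the elements a killed by every smooth g vanishing on [0,oo) *)
Definition Hset (X : CWobj) (a : X) : Prop :=
  forall g : RR -> RR, smooth1 g -> (forall t : RR, 0 <= t -> g t = 0) ->
    op X (fun v : 'rV[RR]_1 => g (v 0 0)) (fun _ => a) = czero X.

End Defs.

(* Main.v *)
(* Evaluating at the points p : X -> R, all of A, M and H turn out to consist of
   the elements that are nonnegative at every point.  A unit lies in U_+ iff it
   is positive at every point: positivity is constant along zigzags
   because a unit of a connected ring has constant sign, and positive reals are
   joined to 1 through C^oo(R).  Since X is W-determined, an equation F(t) = G(t)
   between values of smooth functions of one element holds as soon as, at each
   point p, F and G agree on a half line starting at p(t): all Taylor
   coefficients there coincide.  This gives the invertibility of 1 + c for c
   nonnegative at the points, hence the stability of U_+ under such
   translations, and it identifies H. *)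

Require Import Defs.
From mathcomp Require Import all_boot all_order all_algebra.
From mathcomp Require Import all_classical all_reals all_analysis.
From mathcomp Require Import falgebra.
From mathcomp Require Import ring lra.
Import Defs.

Set Implicit Arguments.
Unset Strict Implicit.
Unset Printing Implicit Defensive.

Import Order.TTheory GRing.Theory Num.Theory.
Import numFieldNormedType.Exports.
Local Open Scope classical_set_scope.
Local Open Scope ring_scope.

(** * Chain rule for functions with continuous partial derivatives *)

Section ChainRule.
Variable R : realType.

Lemma cvg_row (T : Type) (F : set_system T) (FF : Filter F) n
    (f : T -> 'rV[R]_n) (l : 'rV[R]_n) :
  (forall i, f x 0 i @[x --> F] --> l 0 i) -> f x @[x --> F] --> l.
Proof.
move=> fl; apply/cvg_ballP => e e0.
have : \forall x \near F, forall i, ball (l 0 i) e (f x 0 i).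
  by apply: filter_forall => i; have /cvg_ballP := fl i; exact.
apply: filterS => x H; split=> // i j.
by rewrite (ord1 i); exact: H.
Qed.

Lemma cvg_sumr (T : Type) (F : set_system T) (FF : Filter F) n
    (f : 'I_n -> T -> R) (l : 'I_n -> R) :
  (forall i, f i x @[x --> F] --> l i) ->
  \sum_i f i x @[x --> F] --> \sum_i l i.
Proof.
move=> fl; elim: (index_enum _) => [|i r IH].
  by rewrite big_nil; under eq_cvg do rewrite big_nil; exact: cvg_cst.
by rewrite big_cons; under eq_cvg do rewrite big_cons; exact: cvgD.
Qed.

Lemma is_derive_line n (f : 'rV[R]_n -> R) (x v : 'rV[R]_n) (t : R) :
  derivable f (t *: v + x) v ->
  is_derive t 1 (fun s => f (s *: v + x)) ('D_v f (t *: v + x)).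
Proof.
rewrite /derivable /derive => df.
have E : (fun h : R => h^-1 *: (((fun s => f (s *: v + x)) \o shift t) (h *: 1)
            - f (t *: v + x))) =
         (fun h => h^-1 *: ((f \o shift (t *: v + x)) (h *: v) - f (t *: v + x))).
  apply/funext => h /=; congr (_ *: (f _ - _)).
  by rewrite [h *: 1]mulr1 scalerDl addrA.
by split; rewrite /derivable /derive E.
Qed.

(** The corners of a staircase from [a] to [b], along which an increment of a function telescopes
    into increments parallel to the axes. *)
Definition hybrid n (a b : 'rV[R]_n) (k : nat) : 'rV[R]_n :=
  \row_i (if (i < k)%N then b 0 i else a 0 i).

(* Only the k-th coordinate moves between [hybrid a b k] and [hybrid a b k.+1]. *)
Lemma partial_MVT n (F : 'rV[R]_n -> R) (a b : 'rV[R]_n) (k : 'I_n) :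
  (forall x, derivable F x (ebase R k)) ->
  exists c : 'rV[R]_n, (forall i, `|c 0 i - a 0 i| <= `|b 0 i - a 0 i|) /\
    F (hybrid a b k.+1) - F (hybrid a b k) =
    'D_(ebase R k) F c * (b 0 k - a 0 k).
Proof.
move=> dF.
pose g (t : R) := F (t *: ebase R k + hybrid a b k).
have dg (t : R) : is_derive t 1 g ('D_(ebase R k) F (t *: ebase R k + hybrid a b k)).
  exact: is_derive_line.
have cg (A : set R) : {within A, continuous g}.
  apply: continuous_subspaceT => t.
  by apply: differentiable_continuous; apply/derivable1_diffP; case: (dg t).
pose d := b 0 k - a 0 k.
have Eg0 : g 0 = F (hybrid a b k) by rewrite /g scale0r add0r.
have Egd : g d = F (hybrid a b k.+1).
  rewrite /g; congr F; apply/rowP => i; rewrite !mxE eqxx /= ltnS (leq_eqVlt i k).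
  have [->|nik] := eqVneq i k.
    by rewrite eqxx ltnn /= mulr1 /d subrK.
  have /negbTE -> : (i : nat) != k by [].
  by rewrite /= mulr0 add0r.
have [t [tle gE]] : exists t, `|t| <= `|d| /\
    g d - g 0 = 'D_(ebase R k) F (t *: ebase R k + hybrid a b k) * d.
  have [d0|d0] := leP 0 d.
    have [t] := MVT_segment d0 (fun x _ => dg x) (cg _).
    rewrite in_itv /= => /andP[t0 td] E; exists t.
    by rewrite !ger0_norm // E subr0.
  have [t] := MVT_segment (ltW d0) (fun x _ => dg x) (cg _).
  rewrite in_itv /= => /andP[t0 td] E; exists t.
  rewrite !ler0_norm ?lerN2 //; last exact: ltW.
  by split=> //; rewrite -opprB E sub0r mulrN opprK.
exists (t *: ebase R k + hybrid a b k); split; last by rewrite -Egd -Eg0 gE.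
move=> i; rewrite !mxE eqxx /=.
have [->|nik] := eqVneq i k.
  by rewrite ltnn /= mulr1 addrK.
by rewrite mulr0 add0r; case: ifP => // _; rewrite subrr normr0.
Qed.

(** The increment of [F] is telescoped along the hybrids and the mean value theorem is applied to
    each term. The intermediate points are squeezed towards [G x], where continuity of the partial
    derivatives gives the limit. *)
Lemma is_derive_comp_row (V : normedModType R) n (F : 'rV[R]_n -> R)
    (G : V -> 'rV[R]_n) (x v : V) (dG : 'I_n -> R) :
  (forall i y, derivable F y (ebase R i)) ->
  (forall i, continuous ('D_(ebase R i) F)) ->
  (forall i, is_derive x v (fun y => G y 0 i) (dG i)) ->
  is_derive x v (fun y => F (G y)) (\sum_i 'D_(ebase R i) F (G x) * dG i).
Proof.
move=> dF cF dGx.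
pose b (h : R) := G (h *: v + x).
pose q (i : 'I_n) (h : R) := h^-1 * (b h 0 i - G x 0 i).
have qE i : q i h @[h --> 0^'] --> dG i.
  by case: (dGx i) => dG1 <-; exact: dG1.
(* The increment is [h] times the difference quotient, which has a finite limit. *)
have bE i : (b h 0 i - G x 0 i) @[h --> 0^'] --> (0 : R).
  have : h * q i h @[h --> 0^'] --> 0 * dG i.
    by apply: cvgM; [exact: nbhs_dnbhs|exact: qE].
  rewrite mul0r; apply: cvg_trans; apply: near_eq_cvg.
  near=> h; rewrite /q mulrA mulfV ?mul1r //.
  by near: h; exact: nbhs_dnbhs_neq.
have [c cP] : {c : R -> 'I_n -> 'rV[R]_n | forall h k,
    (forall i, `|c h k 0 i - G x 0 i| <= `|b h 0 i - G x 0 i|) /\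
    F (hybrid (G x) (b h) k.+1) - F (hybrid (G x) (b h) k) =
    'D_(ebase R k) F (c h k) * (b h 0 k - G x 0 k)}.
  pose c h k := sval (cid (partial_MVT (G x) (b h) (dF k))).
  by exists c => h k; exact: (svalP (cid (partial_MVT (G x) (b h) (dF k)))).
have cE k : c h k @[h --> 0^'] --> G x.
  apply: cvg_row => i.
  apply/cvgrPdist_le => e e0.
  have /cvgrPdist_le /(_ e e0) := bE i.
  apply: filterS => h; rewrite sub0r normrN => bh.
  by rewrite distrC; apply: le_trans bh; case: (cP h k).
have E : (fun h : R => h^-1 *: (((fun y => F (G y)) \o shift x) (h *: v) - F (G x)))
   = (fun h => \sum_k 'D_(ebase R k) F (c h k) * q k h).
  apply/funext => h /=.
  have <- : hybrid (G x) (b h) n = G (h *: v + x).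
    by apply/rowP => i; rewrite mxE ltn_ord.
  have {2}-> : G x = hybrid (G x) (b h) 0 by apply/rowP => i; rewrite mxE.
  rewrite -(telescope_sumr (fun k => F (hybrid (G x) (b h) k))) // big_mkord.
  rewrite scaler_sumr; apply: eq_bigr => k _.
  by case: (cP h k) => _ ->; rewrite /q /GRing.scale /= mulrCA.
have L : (fun h : R => h^-1 *: (((fun y => F (G y)) \o shift x) (h *: v) - F (G x)))
    @ 0^' --> \sum_i 'D_(ebase R i) F (G x) * dG i.
  rewrite E; apply: cvg_sumr => k; apply: cvgM; last exact: qE.
  exact: (continuous_cvg _ (cF k (G x)) (cE k)).
split; first by apply/cvg_ex; exists (\sum_i 'D_(ebase R i) F (G x) * dG i).
by apply/cvg_lim.
Unshelve. all: by end_near. Qed.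

End ChainRule.

(** * Closure properties of smooth functions *)

Section SmoothClosure.
Variable R : realType.

(** The rules are chosen so that differentiating an expression built with them gives an expression
    of the same kind, once this holds for the members of [P]. *)
Inductive smooth_closure n (P : ('rV[R]_n -> R) -> Prop) :
    ('rV[R]_n -> R) -> Prop :=
  | sc_base f : P f -> smooth_closure P f
  | sc_cst c : smooth_closure P (fun=> c)
  | sc_coord i : smooth_closure P (fun v => v 0 i)
  | sc_add f g : smooth_closure P f -> smooth_closure P g ->
      smooth_closure P (fun v => f v + g v)
  | sc_mul f g : smooth_closure P f -> smooth_closure P g ->
      smooth_closure P (fun v => f v * g v)
  | sc_inv f : (forall v, f v != 0) -> smooth_closure P f ->
      smooth_closure P (fun v => (f v)^-1)
  | sc_comp m (F : 'rV[R]_m -> R) (G : 'I_m -> 'rV[R]_n -> R) :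
      smooth F -> (forall i, smooth_closure P (G i)) ->
      smooth_closure P (fun v => F (\row_i G i v)).

(** One unfolding of smoothness, with [Q] in the place of the smooth functions. *)
Definition has_partials_in n (Q : ('rV[R]_n -> R) -> Prop) (f : 'rV[R]_n -> R) :=
  continuous f /\ forall i, exists df, Q df /\
    forall v, is_derive v (ebase R i) f (df v).

Lemma sc_sum n (P : ('rV[R]_n -> R) -> Prop) m (f : 'I_m -> 'rV[R]_n -> R) :
  (forall i, smooth_closure P (f i)) -> smooth_closure P (fun v => \sum_i f i v).
Proof.
move=> Pf.
suff H (r : seq 'I_m) : smooth_closure P (fun v => \sum_(i <- r) f i v) by exact: H.
elim: r => [|i r IH].
  have -> : (fun v => \sum_(i <- [::]) f i v) = (fun=> 0 : R).
    by apply/funext => v; rewrite big_nil.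
  exact: sc_cst.
have -> : (fun v => \sum_(j <- i :: r) f j v) =
    (fun v => f i v + \sum_(j <- r) f j v).
  by apply/funext => v; rewrite big_cons.
exact: sc_add.
Qed.

Lemma iterD_rcons n (s : seq 'I_n) i (f : 'rV[R]_n -> R) :
  iterD (rcons s i) f = iterD s ('D_(ebase R i) f).
Proof. by elim: s => //= j s ->. Qed.

Lemma smooth_partial n (f : 'rV[R]_n -> R) i :
  smooth f -> smooth ('D_(ebase R i) f).
Proof. by move=> sf s; rewrite -iterD_rcons; exact: sf. Qed.

Lemma smooth_has_partials n (f : 'rV[R]_n -> R) :
  smooth f -> has_partials_in (@smooth R n) f.
Proof.
move=> sf; split; first by case: (sf [::]).
move=> i; exists ('D_(ebase R i) f); split; first exact: smooth_partial.
by move=> v; apply: derivableP; case: (sf [::]).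
Qed.

Lemma smooth_closure_has_partials n (P : ('rV[R]_n -> R) -> Prop) :
  (forall f, P f -> has_partials_in (smooth_closure P) f) ->
  forall f, smooth_closure P f -> has_partials_in (smooth_closure P) f.
Proof.
move=> PP f; elim=> {f}.
- exact: PP.
- move=> c; split; first exact: cst_continuous.
  by move=> i; exists (fun=> 0); split=> [|v]; [exact: sc_cst|exact: is_derive_cst].
- move=> j; split; first exact: coord_continuous.
  move=> i; exists (fun=> (ebase R i) 0 j); split=> [|v]; first exact: sc_cst.
  have cE : (fun h : R => h^-1 *: (((fun w : 'rV[R]_n => w 0 j) \o shift v)
     (h *: ebase R i) - v 0 j)) @ 0^' --> (ebase R i) 0 j.
    have : (fun=> ebase R i 0 j) @ (0 : R)^' --> ebase R i 0 j by exact: cvg_cst.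
    apply: cvg_trans; apply: near_eq_cvg.
    near=> h; rewrite /= !mxE addrK /GRing.scale /= mulrA mulVf ?mul1r //.
    by near: h; exact: nbhs_dnbhs_neq.
  split; last by apply: cvg_lim cE.
  by apply/cvg_ex; exists (ebase R i 0 j).
- move=> f g sf [cf df] sg [cg dg]; split.
    by move=> v; exact: (cvgD (cf v) (cg v)).
  move=> i; have [f' [sf' f'E]] := df i; have [g' [sg' g'E]] := dg i.
  exists (fun v => f' v + g' v); split=> [|v]; first exact: sc_add.
  exact: (is_deriveD (f'E v) (g'E v)).
- move=> f g sf [cf df] sg [cg dg]; split.
    by move=> v; exact: (cvgM (cf v) (cg v)).
  move=> i; have [f' [sf' f'E]] := df i; have [g' [sg' g'E]] := dg i.
  exists (fun v => f v * g' v + g v * f' v); split=> [|v].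
    by apply: sc_add; apply: sc_mul.
  exact: (is_deriveM (f'E v) (g'E v)).
- move=> f f0 sf [cf df]; split.
    by move=> v; exact: (cvgV (f0 v) (cf v)).
  move=> i; have [f' [sf' f'E]] := df i.
  (* The derivative of the inverse is spelled with constants, products and inverses only, so that
     the closure rules apply. *)
  exists (fun v => -1 * ((f v)^-1 * (f v)^-1) * f' v); split=> [|v].
    apply: sc_mul => //; apply: sc_mul; first exact: sc_cst.
    by apply: sc_mul; apply: sc_inv.
  case: (f'E v) => d1 d2; split; first exact: derivableV.
  by rewrite deriveV // d2 mulN1r -invfM -expr2.
- move=> m F G sF sG IH; split.
    move=> v.
    have cG : (fun w => \row_i G i w) @ v --> (\row_i G i v : 'rV[R]_m).
      apply: (cvg_row (nbhs_filter v)) => i; rewrite mxE.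
      have -> : (fun w => (\row_j G j w) 0 i) = G i.
        by apply/funext => w; rewrite mxE.
      by case: (IH i) => + _; exact.
    have [cF _] := sF [::].
    exact: (continuous_cvg _ (cF (\row_i G i v)) cG).
  move=> i.
  have [G' G'P] : {G' : 'I_m -> 'rV[R]_n -> R | forall j, smooth_closure P (G' j) /\
      forall v, is_derive v (ebase R i) (G j) (G' j v)}.
    exists (fun j => sval (cid ((IH j).2 i))) => j.
    exact: (svalP (cid ((IH j).2 i))).
  exists (fun v => \sum_j 'D_(ebase R j) F (\row_k G k v) * G' j v); split.
    apply: sc_sum => j; apply: sc_mul; last by case: (G'P j).
    exact: sc_comp (smooth_partial j sF) sG.
  move=> v; apply: (@is_derive_comp_row _ _ _ F (fun v => \row_i G i v) v).
  + by move=> j y; case: (sF [::]).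
  + by move=> j; case: (smooth_partial j sF [::]).
  + move=> j.
    have -> : (fun w => (\row_k G k w) 0 j) = G j by apply/funext => w; rewrite mxE.
    by case: (G'P j).
Unshelve. all: by end_near. Qed.

(* Coinduction up to the algebraic operations and composition. *)
Lemma smooth_coind n (P : ('rV[R]_n -> R) -> Prop) :
  (forall f, P f -> has_partials_in (smooth_closure P) f) ->
  forall f, smooth_closure P f -> smooth f.
Proof.
move=> /smooth_closure_has_partials PP f Pf s.
suff {s} H s : smooth_closure P (iterD s f).
  have [cs ds] := PP _ (H s); split=> // i v.
  by have [df [_ dfE]] := ds i; case: (dfE v).
elim: s => //= i s IH.
have [_ /(_ i)[df [sdf dfE]]] := PP _ IH.
suff -> : (fun v => 'D_(ebase R i) (iterD s f) v) = df by [].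
by apply/funext => v; case: (dfE v).
Qed.

(** Coinduction with [P] the smooth functions themselves, whose partial derivatives are again
    smooth. All the closure properties below are instances. *)
Lemma smooth_closure_smooth n (f : 'rV[R]_n -> R) :
  smooth_closure (@smooth R n) f -> smooth f.
Proof.
apply: smooth_coind => {}f /smooth_has_partials[cf df]; split=> // i.
by have [g [sg gE]] := df i; exists g; split=> //; exact: sc_base.
Qed.

Lemma smooth_cst n c : smooth (fun _ : 'rV[R]_n => c).
Proof. exact/smooth_closure_smooth/sc_cst. Qed.

Lemma smooth_coord n i : smooth (fun v : 'rV[R]_n => v 0 i).
Proof. exact/smooth_closure_smooth/sc_coord. Qed.

Lemma smoothD n (f g : 'rV[R]_n -> R) :
  smooth f -> smooth g -> smooth (fun v => f v + g v).
Proof. by move=> sf sg; apply/smooth_closure_smooth/sc_add; exact: sc_base. Qed.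

Lemma smoothM n (f g : 'rV[R]_n -> R) :
  smooth f -> smooth g -> smooth (fun v => f v * g v).
Proof. by move=> sf sg; apply/smooth_closure_smooth/sc_mul; exact: sc_base. Qed.

Lemma smoothV n (f : 'rV[R]_n -> R) :
  (forall v, f v != 0) -> smooth f -> smooth (fun v => (f v)^-1).
Proof. by move=> f0 sf; apply/smooth_closure_smooth/sc_inv => //; exact: sc_base. Qed.

Lemma smooth_comp n m (F : 'rV[R]_m -> R) (G : 'I_m -> 'rV[R]_n -> R) :
  smooth F -> (forall i, smooth (G i)) -> smooth (fun v => F (\row_i G i v)).
Proof.
by move=> sF sG; apply/smooth_closure_smooth/sc_comp => // i; exact: sc_base.
Qed.

Lemma smooth1_comp n (F : R -> R) (g : 'rV[R]_n -> R) :
  smooth1 F -> smooth g -> smooth (fun v => F (g v)).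
Proof.
move=> sF sg; have := smooth_comp sF (fun _ : 'I_1 => sg).
by congr smooth; apply/funext => v; rewrite mxE.
Qed.

End SmoothClosure.

(** * Flat functions, a smooth step and a smooth reciprocal *)

Section FlatFunction.
Variable R : realType.

(** [flat 0] is the classical function exp(-1/t). The powers of 1/t are included because
    differentiation produces them: the linear span of the family is stable under it. *)
Definition flat (k : nat) (t : R) : R :=
  if 0 < t then t^-1 ^+ k * expR (- t^-1) else 0.

Lemma flat_le0 k t : t <= 0 -> flat k t = 0.
Proof. by rewrite /flat leNgt => /negbTE ->. Qed.

Lemma flat_ge0 k t : 0 <= flat k t.
Proof.
rewrite /flat; case: ifP => // t0.
by rewrite mulr_ge0 ?expR_ge0 // exprn_ge0 // invr_ge0 ltW.
Qed.

Lemma flat0_gt0 t : 0 < t -> 0 < flat 0 t.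
Proof. by move=> t0; rewrite /flat t0 expr0 mul1r expR_gt0. Qed.

(** From y^(k+2) / (k+2)! <= exp y at y = 1/t. The order 2 is what makes the derivative at the
    origin vanish. *)
Lemma flat_quadratic k t : flat k t <= (k.+2)`!%:R * t ^+ 2.
Proof.
have f0 : 0 < (k.+2)`!%:R :> R by rewrite ltr0n fact_gt0.
rewrite /flat; case: ifP => t0; last by rewrite mulr_ge0 ?sqr_ge0 // ltW.
have y0 : 0 < t^-1 by rewrite invr_gt0.
have := expR_ge1Dxn k.+1 (ltW y0); rewrite expRN => H.
rewrite ler_pdivrMr ?expR_gt0 //.
have {}H : t^-1 ^+ k.+2 / (k.+2)`!%:R <= expR t^-1 by apply: le_trans H; rewrite lerDr.
rewrite ler_pdivrMr // in H.
have -> : t^-1 ^+ k = t ^+ 2 * t^-1 ^+ k.+2.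
  by rewrite -(addn2 k) exprD mulrCA -exprMn mulfV ?gt_eqF // expr1n mulr1.
by rewrite [leRHS]mulrAC [leRHS]mulrC ler_pM2l ?exprn_gt0 // [leRHS]mulrC.
Qed.

Lemma is_derive_flat k (t : R) :
  is_derive t 1 (flat k) (- k%:R * flat k.+1 t + flat k.+2 t).
Proof.
have [t0|t0|->] := ltgtP t 0.
- rewrite !flat_le0 ?ltW // mulr0 addr0.
  have N : \forall s \near t, cst 0 s = flat k s.
    near=> s; rewrite flat_le0 //; near: s.
    by apply: filterS (lt_nbhsl t0) => s /ltW.
  exact: (near_eq_is_derive N (is_derive_cst _ _ _)).
- have N : \forall s \near t, s^-1 ^+ k * expR (- s^-1) = flat k s.
    near=> s; rewrite /flat ifT //; near: s.
    exact: lt_nbhsr t0.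
  apply: (near_eq_is_derive N).
  have tn0 : t != 0 by rewrite gt_eqF.
  have dV : is_derive t 1 (fun s : R => s^-1) (- t ^- 2).
    split; first exact: (derivableV tn0 (@derivable_id _ _ t 1)).
    by rewrite (deriveV tn0 (@derivable_id _ _ t 1)) derive_id [_ *: 1]mulr1.
  have dX : is_derive t 1 (fun s => s^-1 ^+ k) ((k%:R * t^-1 ^+ k.-1) *: - t ^- 2).
    suff -> : (fun s : R => s^-1 ^+ k) = (fun s => s^-1) ^+ k by exact: is_deriveX.
    by apply/funext => s; rewrite exprfctE.
  have dE : is_derive t 1 (fun s => expR (- s^-1)) (expR (- t^-1) * - - t ^- 2).
    exact: (is_derive1_comp (f := expR) (g := fun s => - s^-1)
      (is_derive_expR (- t^-1)) (is_deriveN dV)).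
  apply: is_derive_eq (is_deriveM dX dE) _.
  rewrite /flat t0 /GRing.scale /= opprK -exprVn.
  set E := expR _; case: k {dX N} => [|k] /=; first by rewrite !expr0 !mulr0n; ring.
  by rewrite /= !exprS; ring.
- rewrite !flat_le0 // mulr0 addr0.
  (* At the origin the quadratic bound squeezes the difference quotient between -(k+2)! |h| and
     (k+2)! |h|. *)
  have cE : (fun h : R => h^-1 *: ((flat k \o shift 0) (h *: 1) - flat k 0)) @ 0^'
      --> (0 : R).
    have cB : (k.+2)`!%:R * `|h| @[h --> (0 : R)^'] --> (0 : R).
      have cA : `|h| @[h --> (0 : R)^'] --> `|0 : R|.
        by apply: cvg_norm; exact: nbhs_dnbhs.
      have cC : cst ((k.+2)`!%:R : R) h @[h --> (0 : R)^'] --> ((k.+2)`!%:R : R).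
        exact: cvg_cst.
      have := cvgM cC cA; rewrite normr0 mulr0; apply.
    have cN : - ((k.+2)`!%:R * `|h|) @[h --> (0 : R)^'] --> (0 : R).
      by have := cvgN cB; rewrite oppr0; apply.
    apply: (squeeze_cvgr _ cN cB); near=> h.
    rewrite -ler_norml /= addr0 [h *: 1]mulr1 (flat_le0 k (lexx 0)) subr0.
    have h0 : h != 0 by near: h; exact: nbhs_dnbhs_neq.
    rewrite normrM normfV ler_pdivrMl ?normr_gt0 // ger0_norm ?flat_ge0 //.
    rewrite mulrCA -expr2 real_normK ?num_real //.
    exact: flat_quadratic.
  split; last by apply: cvg_lim cE.
  by apply/cvg_ex; exists 0.
Unshelve. all: by end_near. Qed.

Lemma is_derive_coord0 (g : R -> R) (v : 'rV[R]_1) i d :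
  is_derive (v 0 0) 1 g d ->
  is_derive v (ebase R i) (fun w => g (w 0 0)) d.
Proof.
rewrite (ord1 i) => -[]; rewrite /derivable /derive.
have -> : (fun h : R => h^-1 *: ((g \o shift (v 0 0)) (h *: 1) - g (v 0 0))) =
  (fun h => h^-1 *: (((fun w : 'rV[R]_1 => g (w 0 0)) \o shift v)
     (h *: ebase R 0) - g (v 0 0))).
  by apply/funext => h /=; rewrite !mxE.
by move=> H1 H2; split.
Qed.

(** Coinduction on the whole family at once, since the derivative of one member involves the next
    two. *)
Lemma smooth1_flat k : smooth1 (flat k).
Proof.
pose P (f : 'rV[R]_1 -> R) := exists k, f = fun v => flat k (v 0 0).
apply: (@smooth_coind _ _ P); last by apply: sc_base; exists k.
move=> _ [{}k ->]; split.
  move=> v; apply: (@continuous_comp _ _ _ (fun w : 'rV[R]_1 => w 0 0) (flat k)).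
    exact: coord_continuous.
  apply: differentiable_continuous; apply/derivable1_diffP.
  by case: (is_derive_flat k (v 0 0)).
move=> i; exists (fun v => - k%:R * flat k.+1 (v 0 0) + flat k.+2 (v 0 0)); split.
  apply: sc_add; last by apply: sc_base; exists k.+2.
  by apply: sc_mul; [exact: sc_cst|apply: sc_base; exists k.+1].
by move=> v; apply: is_derive_coord0; exact: is_derive_flat.
Qed.

(** The standard smooth transition from 0 to 1; it serves to produce idempotents. *)
Definition step (t : R) : R := flat 0 t / (flat 0 t + flat 0 (1 - t)).

Lemma step_denominator t : flat 0 t + flat 0 (1 - t) != 0.
Proof.
apply/lt0r_neq0; have [t0|t0] := ltP 0 t.
  by rewrite ltr_wpDr ?flat_ge0 ?flat0_gt0.
by rewrite ltr_wpDl ?flat_ge0 ?flat0_gt0 // subr_gt0; apply: le_lt_trans t0 _.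
Qed.

Lemma step_le0 t : t <= 0 -> step t = 0.
Proof. by move=> t0; rewrite /step flat_le0 // mul0r. Qed.

Lemma step_ge1 t : 1 <= t -> step t = 1.
Proof.
move=> t1; have := step_denominator t; rewrite /step.
by rewrite (flat_le0 0 (_ : 1 - t <= 0)) ?subr_le0 // addr0 => /mulfV.
Qed.

Lemma smooth1_const c : smooth1 (fun _ : R => c).
Proof. exact: smooth_cst. Qed.

Lemma smooth1_id : smooth1 (fun t : R => t).
Proof. exact: smooth_coord. Qed.

Lemma smooth1_opp : smooth1 (fun t : R => - t).
Proof.
have := smoothM (@smooth_cst R 1 (-1)) smooth1_id.
by congr smooth; apply/funext => v; rewrite mulN1r.
Qed.

Lemma smooth1_step : smooth1 step.
Proof.
apply: smoothM; first exact: smooth1_flat.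
apply: (smoothV (f := fun v : 'rV[R]_1 => flat 0 (v 0 0) + flat 0 (1 - v 0 0))).
  by move=> v; exact: step_denominator.
apply: smoothD; first exact: smooth1_flat.
apply: (smooth1_comp (F := flat 0)); first exact: smooth1_flat.
by apply: smoothD; [exact: smooth_cst|exact: smooth1_opp].
Qed.

(* Equals [1 / (t + 1)] for [0 <= t], with the flat function filling in the
   pole of the denominator at [-1]. *)
Definition inv_succ (t : R) : R :=
  (t + 1) / ((t + 1) * (t + 1) + flat 0 (- t)).

Lemma inv_succ_denominator t : (t + 1) * (t + 1) + flat 0 (- t) != 0.
Proof.
have [->|t1] := eqVneq t (-1).
  by rewrite addNr mul0r add0r opprK gt_eqF // flat0_gt0.
apply/lt0r_neq0; rewrite ltr_wpDr ?flat_ge0 //.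
by rewrite -expr2 exprn_even_gt0 //= addr_eq0.
Qed.

Lemma inv_succE t : 0 <= t -> (t + 1) * inv_succ t = 1.
Proof.
move=> t0; have := inv_succ_denominator t; rewrite /inv_succ.
by rewrite (flat_le0 0 (_ : - t <= 0)) ?oppr_le0 // addr0 mulrA => /mulfV.
Qed.

Lemma smooth1_inv_succ : smooth1 inv_succ.
Proof.
have sS : smooth (fun v : 'rV[R]_1 => v 0 0 + 1).
  by apply: smoothD; [exact: smooth1_id|exact: smooth_cst].
apply: smoothM => //; apply: (smoothV (f := fun v : 'rV[R]_1 =>
  (v 0 0 + 1) * (v 0 0 + 1) + flat 0 (- v 0 0))).
  by move=> v; exact: inv_succ_denominator.
apply: smoothD; first exact: smoothM.
by apply: (smooth1_comp (F := flat 0)); [exact: smooth1_flat|exact: smooth1_opp].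
Qed.

End FlatFunction.

(** * Taylor coefficients and operations on Weil algebras *)

Section TaylorExpansion.
Variable R : realType.

(** A derivative is determined by the difference quotients along a single null sequence of nonzero
    steps. Agreement on one side of a point is therefore enough. *)
Lemma derive_eq_along (V : normedModType R) (f g : V -> R) (x v : V) (u : nat -> R) :
  derivable f x v -> derivable g x v ->
  u n @[n --> \oo] --> (0 : R) -> (forall n, u n != 0) ->
  f x = g x -> (forall n, f (u n *: v + x) = g (u n *: v + x)) ->
  'D_v f x = 'D_v g x.
Proof.
move=> df dg u0 un0 fgx fgu.
have uE : u n @[n --> \oo] --> (0 : R)^'.
  move=> A A0; have : \forall n \near \oo, u n != 0 -> A (u n) := u0 _ A0.
  by apply: (@filterS _ \oo) => n /(_ (un0 n)).
pose q (k : V -> R) n := (u n)^-1 *: ((k \o shift x) (u n *: v) - k x).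
have cf : q f @ \oo --> 'D_v f x := cvg_comp _ _ uE df.
have cg : q g @ \oo --> 'D_v g x := cvg_comp _ _ uE dg.
have E : q f = q g by apply/funext => n; rewrite /q /= fgx fgu.
by rewrite E in cf; exact: (cvg_unique _ cf cg).
Qed.

(* [sg = 1] (resp. [-1]) encodes the half line to the right (resp. left) of [r]. *)
Lemma iterD_eq_half_line (F G : 'rV[R]_1 -> R) (sg r : R) :
  sg != 0 -> smooth F -> smooth G ->
  (forall v : 'rV[R]_1, sg * r <= sg * v 0 0 -> F v = G v) ->
  forall s (v : 'rV[R]_1), sg * r <= sg * v 0 0 -> iterD s F v = iterD s G v.
Proof.
move=> sg0 sF sG FG; elim=> [|i s IH] v rv /=; first exact: FG.
(* These steps point into the half line, because [sg * sg] is nonnegative. *)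
apply: (derive_eq_along (u := fun n => sg * n.+1%:R^-1)).
- by case: (sF s).
- by case: (sG s).
- have := @cvg_harmonic R => /(cvgM (cvg_cst sg)).
  by rewrite mulr0; apply.
- by move=> n; rewrite mulf_neq0 // invr_eq0 pnatr_eq0.
- exact: IH.
- move=> n; apply: IH; rewrite !mxE (ord1 i) eqxx /= mulr1 mulrDr mulrA -expr2.
  apply: ler_wpDl => //; apply: mulr_ge0; first exact: sqr_ge0.
  by rewrite invr_ge0.
Qed.

Section Weil.
Variables (W : falgType R) (wW : Weil W).
Implicit Types x y w : W.

Lemma nilp0 : nilp (0 : W).
Proof. by exists 1%N; rewrite expr1. Qed.

Lemma nilpD x y : nilp x -> nilp y -> nilp (x + y).
Proof.
move=> [m xm] [n yn]; exists (m + n)%N.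
rewrite exprDn_comm; last by case: wW => + _; exact.
apply: big1 => i _; have [ni|im] := leqP n i.
  by rewrite -(subnKC ni) exprD yn mul0r mulr0 mul0rn.
have -> : (m + n - i = m + (n - i))%N by rewrite addnBA // ltnW.
by rewrite exprD xm !mul0r mul0rn.
Qed.

Lemma nilpM x y : nilp x -> nilp (x * y).
Proof.
move=> [m xm]; exists m; rewrite exprMn_comm; last by case: wW => + _; exact.
by rewrite xm mul0r.
Qed.

Lemma nilpZ (a : R) x : nilp x -> nilp (a *: x).
Proof. by move=> [m xm]; exists m; rewrite exprZn xm scaler0. Qed.

Lemma nilp_sum (I : Type) (r : seq I) (f : I -> W) :
  (forall i, nilp (f i)) -> nilp (\sum_(i <- r) f i).
Proof. by move=> H; elim/big_ind: _ => //; [exact: nilp0|exact: nilpD]. Qed.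

Lemma nilp_scalar (a : R) : nilp (a%:A : W) -> a = 0.
Proof.
move=> [m]; rewrite exprZn expr1n => /eqP.
by rewrite scaler_eq0 oner_eq0 orbF expf_eq0 => /andP[_ /eqP].
Qed.

Lemma wpartP w : nilp (w - (wpart w)%:A).
Proof.
case: wW => _ /(_ w).
exact: (ClassicalEpsilon.epsilon_spec _ (fun a => nilp (w - a%:A))).
Qed.

(** Two candidates differ by a nilpotent scalar, which is zero; hence the choice made in [wpart] is
    harmless. *)
Lemma wpart_unique w (a : R) : nilp (w - a%:A) -> wpart w = a.
Proof.
move=> wa; apply/eqP; rewrite -subr_eq0; apply/eqP/nilp_scalar.
have -> : (wpart w - a)%:A = (w - a%:A) + (-1) *: (w - (wpart w)%:A).
  by rewrite scaleN1r opprB scalerBl [RHS]addrC addrA subrK.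
by apply: nilpD => //; apply: nilpZ; exact: wpartP.
Qed.

(** The Taylor term of order 0 is the value at the real parts, and every term of higher order
    contains a nilpotent factor. *)
Lemma weilOp_nilp n (f : 'rV[R]_n -> R) (ws : 'I_n -> W) :
  nilp (weilOp f ws - (f (\row_i wpart (ws i)))%:A).
Proof.
rewrite /weilOp big_ord_recl /= fact0 invr1 scale1r.
rewrite (big_pred1 [tuple]) => [|s]; last by rewrite (tuple0 s) /= eq_refl.
rewrite big_ord0 /= addrC addKr.
apply: nilp_sum => k; apply: nilpZ; apply: nilp_sum => s; apply: nilpZ.
by rewrite big_ord_recl; apply: nilpM; exact: wpartP.
Qed.

Lemma wpart_weilOp n (f : 'rV[R]_n -> R) (ws : 'I_n -> W) :
  wpart (weilOp f ws) = f (\row_i wpart (ws i)).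
Proof. exact/wpart_unique/weilOp_nilp. Qed.

(** Composition with this map turns a homomorphism to a Weil algebra into a point. *)
Lemma wpart_hom : is_hom (@wpart R W : weilC W -> realC R).
Proof. by move=> n f ws _; exact: wpart_weilOp. Qed.

End Weil.

Lemma nilp_regular (a : R^o) : nilp a -> a = 0.
Proof. by move=> [m /eqP]; rewrite expf_eq0 => /andP[_ /eqP]. Qed.

(** The case of zero nilpotent ideal: it lets points count among the maps that test
    W-determinacy. *)
Lemma Weil_regular : Weil R^o.
Proof.
split=> [x y|w]; first exact: mulrC.
by exists w; exists 1%N; rewrite [w%:A]mulr1 subrr expr1.
Qed.

Lemma weilOp_regular n (f : 'rV[R]_n -> R) (ws : 'I_n -> R^o) :
  weilOp f ws = f (\row_i ws i).
Proof.
have wE (w : R^o) : wpart w = w.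
  apply: (wpart_unique Weil_regular); exists 1%N.
  by rewrite [w%:A]mulr1 subrr expr1.
have /nilp_regular/eqP := weilOp_nilp Weil_regular f ws.
rewrite subr_eq0 [_%:A]mulr1 => /eqP ->.
by congr f; apply/rowP => i; rewrite !mxE wE.
Qed.

Lemma realC_weilC (A : preC R) (p : A -> realC R) :
  is_hom p -> is_hom (p : A -> weilC R^o).
Proof. by move=> hp n f xs sf; rewrite (hp n f xs sf) /= weilOp_regular. Qed.

End TaylorExpansion.

(** * Ring operations derived from the smooth operations *)

Section Algebra.
Variable R : realType.

Lemma hom_comp (A B C : preC R) (g : B -> C) (f : A -> B) :
  is_hom g -> is_hom f -> is_hom (g \o f).
Proof. by move=> hg hf n F xs sF /=; rewrite hf // hg. Qed.

Lemma smooth_add2 : smooth (fun v : 'rV[R]_2 => v 0 0 + v 0 1).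
Proof. by apply: smoothD; exact: smooth_coord. Qed.

Lemma smooth_mul2 : smooth (fun v : 'rV[R]_2 => v 0 0 * v 0 1).
Proof. by apply: smoothM; exact: smooth_coord. Qed.

Section Hom.
Variables (A B : preC R) (h : A -> B) (hh : is_hom h).

Lemma hom_args2 (f : 'rV[R]_2 -> R) x y :
  smooth f -> h (op f (args2 x y)) = op f (args2 (h x) (h y)).
Proof.
by move=> sf; rewrite hh //; congr op; apply/funext => i; rewrite /args2; case: ifP.
Qed.

Lemma hom_add x y : h (cadd x y) = cadd (h x) (h y).
Proof. exact: hom_args2 smooth_add2. Qed.

Lemma hom_mul x y : h (cmul x y) = cmul (h x) (h y).
Proof. exact: hom_args2 smooth_mul2. Qed.

Lemma hom_noargs c :
  h (op (fun _ : 'rV[R]_0 => c) (@noargs A)) = op (fun=> c) (@noargs B).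
Proof.
by rewrite hh; [congr op; apply/funext => -[]|exact: smooth_cst].
Qed.

Lemma hom_one : h (cone A) = cone B. Proof. exact: hom_noargs. Qed.

Lemma hom_zero : h (czero A) = czero B. Proof. exact: hom_noargs. Qed.

End Hom.

Lemma realC_add (x y : R) : cadd (x : realC R) y = x + y.
Proof. by rewrite /cadd /= !mxE. Qed.

Lemma realC_mul (x y : R) : cmul (x : realC R) y = x * y.
Proof. by rewrite /cmul /= !mxE. Qed.

Variable A : CRing R.

Definition op1 (F : R -> R) (t : A) : A :=
  op (fun v : 'rV[R]_1 => F (v 0 0)) (fun=> t).

Lemma op_args2 n (f : 'rV[R]_2 -> R) (g1 g2 : 'rV[R]_n -> R) (xs : 'I_n -> A) :
  smooth f -> smooth g1 -> smooth g2 ->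
  op f (args2 (op g1 xs) (op g2 xs)) =
  op (fun v => f (\row_i args2 (g1 v) (g2 v) i)) xs.
Proof.
move=> sf s1 s2.
have sg i : smooth (args2 g1 g2 i) by rewrite /args2; case: ifP.
have -> : args2 (op g1 xs) (op g2 xs) = fun i => op (args2 g1 g2 i) xs.
  by apply/funext => i; rewrite /args2; case: ifP.
rewrite -(cr_comp (c := A) xs sf sg); congr op; apply/funext => v; congr f.
by apply/rowP => i; rewrite !mxE /args2; case: ifP.
Qed.

Lemma add_op n (f g : 'rV[R]_n -> R) (xs : 'I_n -> A) :
  smooth f -> smooth g -> cadd (op f xs) (op g xs) = op (fun v => f v + g v) xs.
Proof.
move=> sf sg; rewrite /cadd op_args2 //; last exact: smooth_add2.
by congr op; apply/funext => v; rewrite !mxE.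
Qed.

Lemma mul_op n (f g : 'rV[R]_n -> R) (xs : 'I_n -> A) :
  smooth f -> smooth g -> cmul (op f xs) (op g xs) = op (fun v => f v * g v) xs.
Proof.
move=> sf sg; rewrite /cmul op_args2 //; last exact: smooth_mul2.
by congr op; apply/funext => v; rewrite !mxE.
Qed.

Lemma op_cst n c (xs : 'I_n -> A) :
  op (fun=> c) xs = op (fun _ : 'rV[R]_0 => c) (@noargs A).
Proof.
rewrite (cr_comp (f := fun _ : 'rV[R]_0 => c) (g := @noargs _)).
- by congr op; apply/funext => -[].
- exact: smooth_cst.
- by case.
Qed.

Lemma op1_one t : op1 (fun=> 1) t = cone A. Proof. exact: op_cst. Qed.

Lemma op1_zero t : op1 (fun=> 0) t = czero A. Proof. exact: op_cst. Qed.

Lemma op1_id t : op1 id t = t.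
Proof. exact: (cr_proj (c := A) (n := 1) 0 (fun=> t)). Qed.

Lemma op1_add F G t : smooth1 F -> smooth1 G ->
  cadd (op1 F t) (op1 G t) = op1 (fun s => F s + G s) t.
Proof. exact: add_op. Qed.

Lemma op1_mul F G t : smooth1 F -> smooth1 G ->
  cmul (op1 F t) (op1 G t) = op1 (fun s => F s * G s) t.
Proof. exact: mul_op. Qed.

Let args3 (x y z : A) (i : 'I_3) : A := nth x [:: x; y; z] i.
Let co (i : 'I_3) : 'rV[R]_3 -> R := fun v => v 0 i.
Let i1 : 'I_3 := Ordinal (isT : (1 < 3)%N).
Let i2 : 'I_3 := Ordinal (isT : (2 < 3)%N).

(** The three elements are coordinates of one triple, so each side is a single operation applied to
    it, and the law is inherited from the reals. *)
Lemma cmulA (x y z : A) : cmul x (cmul y z) = cmul (cmul x y) z.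
Proof.
pose xs := args3 x y z.
have xE : x = op (co 0) xs by rewrite cr_proj.
have yE : y = op (co i1) xs by rewrite cr_proj.
have zE : z = op (co i2) xs by rewrite cr_proj.
have sc i : smooth (co i) by exact: smooth_coord.
move: xs xE yE zE => xs -> -> ->; rewrite !mul_op //; try exact: smoothM.
by congr op; apply/funext => v; rewrite mulrA.
Qed.

Lemma cmulDl (x y z : A) : cmul (cadd x y) z = cadd (cmul x z) (cmul y z).
Proof.
pose xs := args3 x y z.
have xE : x = op (co 0) xs by rewrite cr_proj.
have yE : y = op (co i1) xs by rewrite cr_proj.
have zE : z = op (co i2) xs by rewrite cr_proj.
have sc i : smooth (co i) by exact: smooth_coord.
move: xs xE yE zE => xs -> -> ->.
rewrite add_op // !mul_op ?add_op //; try exact: smoothM; try exact: smoothD.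
by congr op; apply/funext => v; rewrite mulrDl.
Qed.

End Algebra.

(** * Equations and units in W-determined rings *)

Section WDetermined.
Variable R : realType.

Lemma op1_eq (A : CRing R) (t : A) (F G : R -> R) :
  W_determined A -> smooth1 F -> smooth1 G ->
  (forall p : A -> realC R, is_hom p ->
     (forall s, p t <= s -> F s = G s) \/ (forall s, s <= p t -> F s = G s)) ->
  op1 F t = op1 G t.
Proof.
move=> Wdet sF sG FG; apply: Wdet => W wW h hh.
rewrite /op1 (hh _ _ _ sF) (hh _ _ _ sG); apply: eq_bigr => k _; congr (_ *: _).
apply: eq_bigr => s _; congr (_ *: _).
have N1 : (-1 : R) != 0 by rewrite oppr_eq0 oner_neq0.
(* The relevant point is the real part of [h]: its value at [t] is the centre of both Taylor
   expansions. *)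
have [H|H] := FG _ (hom_comp (wpart_hom wW) hh).
- apply: (iterD_eq_half_line (r := wpart (h t)) (oner_neq0 R) sF sG).
    by move=> v; rewrite !mul1r; exact: H.
  by rewrite mxE.
- apply: (iterD_eq_half_line (r := wpart (h t)) N1 sF sG).
    by move=> v; rewrite !mulN1r lerN2; exact: H.
  by rewrite mxE.
Qed.

Lemma hom_op1 (A : CRing R) (p : A -> realC R) F t :
  is_hom p -> smooth1 F -> p (op1 F t) = F (p t).
Proof. by move=> hp sF; rewrite /op1 hp //= mxE. Qed.

(* For a unit [u] with inverse [v], the element [u + v] avoids ]-2, 2[, so
   [step (u + v)] is the idempotent splitting the sign of [u]. *)
Lemma unit_sign (X : CWobj R) (u : X) (p q : X -> realC R) :
  isunit u -> is_hom p -> is_hom q -> 0 < p u -> 0 < q u.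
Proof.
move=> [v uv] hp hq pu; rewrite ltNge; apply/negP => qu.
have inv (r : X -> realC R) : is_hom r -> r u * r v = 1.
  by move=> hr; rewrite -realC_mul -hom_mul // uv hom_one.
(* The bounds 1 and 0 are weaker than 2 and -2, but they are the thresholds beyond which [step] is
   constant. *)
have ge1 (r : X -> realC R) : is_hom r -> 0 < r u -> 1 <= r (cadd u v).
  move=> hr ru; rewrite hom_add // realC_add.
  have := inv r hr; move: ru; set a : R := r u; set b : R := r v => a0 ab; nra.
have le0 (r : X -> realC R) : is_hom r -> r u <= 0 -> r (cadd u v) <= 0.
  move=> hr ru; rewrite hom_add // realC_add.
  have := inv r hr; move: ru; set a : R := r u; set b : R := r v => a0 ab; nra.
have sS := @smooth1_step R.
have sSS : smooth1 (fun s : R => step s * step s) := smoothM sS sS.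
pose e := op1 (@step R) (cadd u v).
have ee : cmul e e = e.
  rewrite /e (op1_mul _ sS sS); apply: (op1_eq (@cw_Wdet R X) sSS sS).
  (* The half line is taken on the side where [step] stays constant: to the right for positive
     values of [u], to the left otherwise. *)
  move=> r hr; have [ru|ru] := ltP 0 (r u); [left|right] => s Hs.
    by rewrite step_ge1 ?mulr1 // (le_trans (ge1 r hr ru)).
  by rewrite step_le0 ?mulr0 // (le_trans Hs) // le0.
have pe : p e = 1 by rewrite hom_op1 // step_ge1 // ge1.
have qe : q e = 0 by rewrite hom_op1 // step_le0 // le0.
have [_ /(_ _ ee)[E|E]] := cw_conn X.
- by have := hom_zero hp; rewrite -E pe => /eqP; rewrite /czero /= oner_eq0.
- by have := hom_one hq; rewrite -E qe => /eqP; rewrite /cone /= eq_sym oner_eq0.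
Qed.

Lemma isunit_add1 (X : CWobj R) (c : X) :
  (forall p : X -> realC R, is_hom p -> 0 <= p c) -> isunit (cadd c (cone X)).
Proof.
move=> c0; exists (op1 (@inv_succ R) c).
have s1 : smooth1 (fun _ : R => 1) by exact: smooth1_const.
have sid := @smooth1_id R; have sI := @smooth1_inv_succ R.
have sS : smooth1 (fun s : R => s + 1) := smoothD sid s1.
have sP : smooth1 (fun s : R => (s + 1) * inv_succ s) := smoothM sS sI.
rewrite -{1}(op1_id c) -(op1_one c) (op1_add _ sid s1) (op1_mul _ sS sI).
apply: (op1_eq (@cw_Wdet R X) sP s1).
by move=> p hp; left => s ps; apply: inv_succE; apply: le_trans ps; exact: c0.
Qed.

(** With [v] the inverse of [u], one has b + u = (b v + 1) u, and b v is nonnegative at every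
    point. *)
Lemma isunit_add (X : CWobj R) (b u : X) :
  isunit u -> (forall p : X -> realC R, is_hom p -> 0 <= p b /\ 0 < p u) ->
  isunit (cadd b u).
Proof.
move=> [v uv] bu.
have [|w bvw] := @isunit_add1 X (cmul b v).
  move=> p hp; have [pb pu] := bu p hp.
  have := congr1 p uv; rewrite !hom_mul // hom_one // !realC_mul /cone /=.
  move=> E; apply: mulr_ge0 => //; rewrite -(pmulr_rge0 _ pu).
  by have -> : p u * p v = 1 by exact: E.
by exists (cmul v w); rewrite cmulA cmulDl uv.
Qed.

End WDetermined.

(** * The objects given by the reals and by the smooth functions on the line *)

Section Objects.
Variable R : realType.

Definition realCRing : CRing R.
Proof.
apply: (@CRingMk R (realC R)) => [n i xs|//]; exact: mxE.
Defined.

Lemma realC_fin_gen : fin_gen realCRing.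
Proof.
exists 0%N, (@noargs _) => a; exists (fun=> a); split=> //; exact: smooth_cst.
Qed.

Lemma id_hom (A : preC R) : is_hom (fun x : A => x).
Proof. by []. Qed.

Lemma realC_W_determined : W_determined realCRing.
Proof.
move=> a b H; apply: (H R^o (Weil_regular R)).
exact: realC_weilC (@id_hom (realC R)).
Qed.

Lemma realC_connected : connectedC realCRing.
Proof.
split; first by rewrite /cone /czero /=; exact/eqP/oner_neq0.
move=> e; rewrite realC_mul /cone /czero /= => ee.
have /eqP : (e : R) * (e - 1) = 0 by rewrite mulrBr mulr1 ee subrr.
by rewrite mulf_eq0 subr_eq0 => /orP[] /eqP ->; [left|right].
Qed.

Definition realObj : CWobj R :=
  CWObj realC_fin_gen realC_W_determined realC_connected
    (ex_intro _ _ (@id_hom (realC R))).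

Definition smoothfun := {f : 'rV[R]_1 -> R | smooth f}.

(** Operations must be total, so a function that is not smooth is sent to the default value zero. *)
Definition smoothfun_op n (f : 'rV[R]_n -> R) (xs : 'I_n -> smoothfun) : smoothfun :=
  match pselect (smooth f) with
  | left sf => exist _ _ (smooth_comp sf (fun i => svalP (xs i)))
  | right _ => exist _ _ (@smooth_cst R 1 0)
  end.

Definition smoothfunC : preC R := @PreC R smoothfun smoothfun_op.

Definition eval (x : 'rV[R]_1) (f : smoothfunC) : realC R := sval f x.

Lemma eval_hom x : is_hom (eval x).
Proof.
by move=> n f xs sf; rewrite /eval /= /smoothfun_op; case: pselect.
Qed.

Lemma eval_inj (f g : smoothfunC) : (forall x, eval x f = eval x g) -> f = g.
Proof.
case: f g => f sf [g sg] fg; have E : f = g by apply/funext.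
by case: _ / E sg {fg} => sg; congr exist; exact: Prop_irrelevance.
Qed.

Definition smoothfunCRing : CRing R.
Proof.
apply: (@CRingMk R smoothfunC) => [n i xs|n m f g xs sf sg]; apply: eval_inj => x.
  by rewrite (eval_hom x) /= ?mxE //; exact: smooth_coord.
rewrite !(eval_hom x) //=; last exact: smooth_comp.
by congr f; apply/rowP => i; rewrite !mxE (eval_hom x).
Defined.

Lemma smoothfun_fin_gen : fin_gen smoothfunCRing.
Proof.
exists 1%N, (fun=> exist _ _ (@smooth_coord R 1 0)) => -[f sf]; exists f; split=> //.
apply: eval_inj => x; rewrite (eval_hom x) //= /eval /=.
by congr f; apply/rowP => i; rewrite mxE (ord1 i).
Qed.

Lemma smoothfun_W_determined : W_determined smoothfunCRing.
Proof.
move=> f g H; apply: eval_inj => x; apply: (H R^o (Weil_regular R)).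
exact: realC_weilC (eval_hom x).
Qed.

Lemma eval_one x : eval x (cone smoothfunCRing) = 1.
Proof. exact: (hom_one (eval_hom x)). Qed.

Lemma eval_zero x : eval x (czero smoothfunCRing) = 0.
Proof. exact: (hom_zero (eval_hom x)). Qed.

(** An idempotent takes only the values 0 and 1. If it took both, the intermediate value theorem
    would give the value 1/2. *)
Lemma smoothfun_connected : connectedC smoothfunCRing.
Proof.
split.
  move=> E; have := eval_one 0; rewrite E eval_zero => /eqP.
  by rewrite eq_sym oner_eq0.
move=> e ee.
have e01 x : eval x e = 0 \/ eval x e = 1.
  have := congr1 (eval x) ee; rewrite (hom_mul (eval_hom x)) realC_mul => E.
  have /eqP : (eval x e : R) * (eval x e - 1) = 0 by rewrite mulrBr mulr1 E subrr.
  by rewrite mulf_eq0 subr_eq0 => /orP[] /eqP ->; [left|right].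
pose g (t : R) : R := sval e (const_mx t).
have cg : continuous g.
  move=> t; have [ce _] := svalP e [::].
  have cc : (fun t : R => const_mx t) @ t --> (const_mx t : 'rV[R]_1).
    apply: (cvg_row (nbhs_filter t)) => i; rewrite mxE.
    have -> : (fun s : R => (const_mx s : 'rV[R]_1) 0 i) = id.
      by apply/funext => s; rewrite mxE.
    exact: cvg_id.
  exact: (continuous_cvg _ (ce (const_mx t)) cc).
have gconst s t : s <= t -> g s = g t.
  move=> st; have [gs|gs] := e01 (const_mx s); have [gt|gt] := e01 (const_mx t);
    rewrite /eval /= -/(g _) -/(g _) in gs gt; rewrite ?gs ?gt //.
  - have [|c _ gc] := @IVT R g s t (2^-1) st (continuous_subspaceT cg).
      by rewrite gs gt /Num.min /Num.max; case: ltP => *; apply/andP; split; lra.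
    by have [] := e01 (const_mx c); rewrite /eval /= -/(g _) gc => E; exfalso; move: E; lra.
  - have [|c _ gc] := @IVT R g s t (2^-1) st (continuous_subspaceT cg).
      by rewrite gs gt /Num.min /Num.max; case: ltP => *; apply/andP; split; lra.
    by have [] := e01 (const_mx c); rewrite /eval /= -/(g _) gc => E; exfalso; move: E; lra.
have eE x : eval x e = g 0.
  have -> : eval x e = g (x 0 0).
    by rewrite /eval /g; congr (sval e _); apply/rowP => i; rewrite mxE (ord1 i).
  by have [/gconst|/ltW/gconst] := leP (x 0 0) 0.
have [g0|g1] := e01 0; [left|right]; apply: eval_inj => x.
  by rewrite eval_zero eE -(eE 0).
by rewrite eval_one eE -(eE 0).
Qed.

Definition lineObj : CWobj R :=
  CWObj smoothfun_fin_gen smoothfun_W_determined smoothfun_connected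
    (ex_intro _ _ (eval_hom 0)).

End Objects.

(** * Zigzags of units and the pointwise description of the subobjects *)

Section Connectedness.
Variable R : realType.

Lemma zz_pos (c d : R) : 0 < c -> c <= d ->
  zz (existT _ (realObj R) c) (existT _ (realObj R) d).
Proof.
move=> c0 cd.
(* A smooth function equal to [c] at 0 and [d] at 1. The square keeps it at least [c], hence a unit,
   on the whole line; the two evaluations then form the zigzag. *)
pose f (v : 'rV[R]_1) := c + (d - c) * (v 0 0 * v 0 0).
have sf : smooth f.
  apply: smoothD; first exact: smooth_cst.
  by apply: smoothM; [exact: smooth_cst|apply: smoothM; exact: smooth_coord].
have f0 v : f v != 0.
  rewrite gt_eqF // /f ltr_pwDl // mulr_ge0 ?subr_ge0 //.
  by rewrite -expr2 sqr_ge0.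
pose F : lineObj R := exist _ f sf.
have uF : isunit F.
  exists (exist _ _ (smoothV f0 sf) : smoothfunC R); apply: eval_inj => x.
  rewrite (hom_mul (eval_hom x)) (hom_one (eval_hom x)) realC_mul /eval /=.
  by rewrite mulfV.
have step0 (x : 'rV[R]_1) : zz (existT _ (lineObj R) F) (existT _ (realObj R) (f x)).
  exact: (@zz_step R (lineObj R) (realObj R) (eval x) F (eval_hom x) uF).
have Ec : f 0 = c by rewrite /f mxE mulr0 mulr0 addr0.
have Ed : f (const_mx 1) = d by rewrite /f mxE mulr1 mulr1 addrC subrK.
have := step0 0; rewrite Ec => /zz_sym zc.
by have := step0 (const_mx 1); rewrite Ed; exact: zz_trans zc.
Qed.

Lemma zz_pos_one (c : R) : 0 < c ->
  zz (existT _ (realObj R) c) (existT _ (realObj R) (1 : R)).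
Proof.
move=> c0; have [c1|c1] := leP c 1; first exact: zz_pos.
by apply: zz_sym; apply: zz_pos => //; exact: ltW.
Qed.

(** Along [h : X -> Y], points of [Y] restrict to points of [X]. Conversely [Y] has some point, and
    positivity at its restriction spreads to all points of [X] by [unit_sign]. *)
Lemma zz_point_gt0 (x y : elU R) : zz x y ->
  (forall p : projT1 x -> realC R, is_hom p -> 0 < p (projT2 x)) <->
  (forall p : projT1 y -> realC R, is_hom p -> 0 < p (projT2 y)).
Proof.
elim=> {x y} [X Y h u hh uu|//|x y _ [] //|x y z _ [xy yx] _ [yz zy]].
- split=> /= [H p hp|H p hp]; first exact: (H (p \o h) (hom_comp hp hh)).
  have [q hq] := cw_pt Y.
  exact: (unit_sign uu (hom_comp hq hh) hp (H q hq)).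
- by split=> [/xy/yz|/zy/yx].
Qed.

Lemma UplusP (X : CWobj R) (u : X) :
  Uplus u <-> isunit u /\ forall p : X -> realC R, is_hom p -> 0 < p u.
Proof.
split=> [[uu [Y XY]]|[uu up]]; split=> //.
  apply/(zz_point_gt0 XY) => /= p hp; rewrite (hom_one hp); exact: ltr01.
(* The unit is joined to its value at one point, and that positive real to 1. *)
exists (realObj R); have [p hp] := cw_pt X.
apply: zz_trans (zz_pos_one (up p hp)).
exact: (@zz_step R X (realObj R) p u hp uu).
Qed.

Lemma AsetP (X : CWobj R) (a : X) :
  Aset a <-> forall p : X -> realC R, is_hom p -> 0 <= p a.
Proof.
split=> [Aa p hp|a0 Y h hh u /UplusP[uu up]].
  (* Testing at the stage of the reals with each constant e > 0 in U_+ yields p(a) + e > 0. *)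
  apply/ler_addgt0Pr => e e0.
  have : Uplus (e : realObj R).
    apply/UplusP; split.
      by exists (e^-1 : R); rewrite realC_mul mulfV ?gt_eqF.
    (* A real number is a constant operation, hence fixed by every homomorphism [q]. *)
    move=> q hq; have eE : e = op1 (fun=> e) (0 : realCRing R) by [].
    by rewrite [X in q X]eE (hom_op1 _ hq (smooth1_const e)).
  move=> /(Aa (realObj R) p hp)/UplusP[_ /(_ _ (@id_hom _ (realC R)))].
  by rewrite realC_add => /ltW.
apply/UplusP; split.
  apply: isunit_add => // q hq; split; last exact: up.
  exact: (a0 _ (hom_comp hq hh)).
move=> q hq; rewrite hom_add // realC_add; apply: ltr_wpDl; last exact: up.
exact: (a0 _ (hom_comp hq hh)).
Qed.

Lemma MsetP (X : CWobj R) (a : X) :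
  Mset a <-> forall p : X -> realC R, is_hom p -> 0 <= p a.
Proof.
split=> [Ma p hp|a0 Y h hh b /AsetP b0]; last first.
  apply/AsetP => q hq; rewrite hom_mul // realC_mul; apply: mulr_ge0; last exact: b0.
  exact: (a0 _ (hom_comp hq hh)).
(* Multiplying by 1, which lies in A, puts the multiplier itself in A. *)
have A1 : Aset (cone X).
  by apply/AsetP => q hq; rewrite (hom_one hq); exact: ler01.
have /AsetP/(_ p hp) := Ma X _ (@id_hom _ X) _ A1.
rewrite hom_mul // realC_mul (hom_one hp).
by have -> : (p a : R) * cone (realC R) = p a by exact: mulr1.
Qed.

(** The function [flat 0 (- t)] vanishes exactly on the closed half line, so it detects a negative
    value. Conversely a function vanishing there agrees with 0 to the right of every [p a]. *)
Lemma HsetP (X : CWobj R) (a : X) :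
  Hset a <-> forall p : X -> realC R, is_hom p -> 0 <= p a.
Proof.
split=> [Ha p hp|a0 g sg g0].
  rewrite leNgt; apply/negP => pa.
  have sF : smooth1 (fun t : R => flat 0 (- t)).
    by apply: (smooth1_comp (F := flat 0)); [exact: smooth1_flat|exact: smooth1_opp].
  have F0 : op1 (fun t : R => flat 0 (- t)) a = czero X.
    by apply: Ha => // t t0; apply: flat_le0; rewrite oppr_le0.
  have := hom_op1 a hp sF; rewrite F0 (hom_zero hp) => /esym/eqP.
  by rewrite gt_eqF // flat0_gt0 // oppr_gt0.
rewrite -/(op1 g a) -(op1_zero a).
apply: (op1_eq (@cw_Wdet R X) sg (smooth1_const 0)) => p hp.
by left => s ps; apply: g0; apply: le_trans ps; exact: a0.
Qed.

End Connectedness.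

Theorem theorem5p6 (R : realType) (X : CWobj R) (a : car X) : Mset a <-> Hset a.
Proof. by rewrite MsetP HsetP. Qed.
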